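(* Let $K$ be a commutative discrete hypergroup and let $H$ be a finite subgroup of the center $Z(K)$. If $K$ is an almost-Ramsey hypergroup, then the hypergroup $K//H$ is an almost-Ramsey hypergroup.
   Context: A discrete hypergroup is a set $K$ (discrete topology) with a map assigning to $m,n\in K$ a finitely supported probability measure $\delta_m*\delta_n$ (extended bilinearly to measures), associative, with identity $e$, and an involution $m\mapsto\check m$ with $(\delta_m*\delta_n)^\vee=\delta_{\check n}*\delta_{\check m}$ and $e\in\operatorname{spt}(\delta_m*\delta_{\check n})$ iff $m=n$; commutative if $\delta_m*\delta_n=\delta_n*\delta_m$. $Z(K)$ is the set of $x\in K$ with $\operatorname{spt}(\delta_x*\delta_y)$ a singleton for all $y$; it is a group. For $x\in K$, $z\in Z(K)$, $xz$ is the unique element of $\operatorname{spt}(\delta_x*\delta_z)$. For a subgroup $H\subset Z(K)$, $K//H=\{xH:x\in K\}$, $xH=\{xz:z\in H\}$, $\pi(x)=[x]=xH$, and $\delta_{[x]}*\delta_{[y]}$ is the image of $\delta_x*\delta_y$ under $\pi$; this makes $K//H$ a hypergroup with identity $[e]$. For an infinite discrete hypergroup $L$ with identity $e$ and an injective sequence $\langle x_n\rangle$ in $L\setminus\{e\}$ with range $B$, for nonempty finite $F=\{x_{n_1},\dots,x_{n_m}\}\subset B$ with $n_1<\dots<n_m$ put $\delta_F=\delta_{x_{n_1}}*\cdots*\delta_{x_{n_m}}$, and let $\mathrm{SFC}(\langle x_n\rangle)=\{\operatorname{spt}(\delta_F): F\subset B \text{ nonempty finite}\}$. $L$ is an almost-Ramsey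 hypergroup if for every finite partition $L=\bigcup_{i=1}^rC_i$ there exist $i$, an injective sequence $\langle x_n\rangle$ in $L\setminus\{e\}$, and a finite subset $\mathcal F\subset \mathrm{SFC}(\langle x_n\rangle)$ such that every member of $\mathrm{SFC}(\langle x_n\rangle)\setminus\mathcal F$ is a subset of $C_i$. *)

(* Defs.v *)
From HB Require Import structures.
From mathcomp Require Import all_boot all_order all_algebra finmap.
From mathcomp.multinomials Require Import monalg.
From mathcomp Require Import mathcomp_extra boolp classical_sets functions.
From mathcomp Require Import cardinality reals.

Set Implicit Arguments.
Unset Strict Implicit.
Unset Printing Implicit Defensive.

Import Order.TTheory GRing.Theory Num.Theory.

Local Open Scope classical_set_scope.
Local Open Scope ring_scope.

(* A finitely supported signed measure on K is an element mu of the free      *)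
(* module {malg R[K]}: mu@_k is the mass of {k}, msupp mu is the support and  *)
(* << k >> is the point mass at k.                                            *)

Definition is_prob (R : realType) (K : choiceType) (mu : {malg R[K]}) :=
  (forall k, 0 <= mu@_k) /\ \sum_(k <- msupp mu) mu@_k = 1.

(* The linear extension of f to signed measures. *)
HB.lock Definition mlift (R : realType) (K : choiceType) (V : lmodType R)
    (f : K -> V) (mu : {malg R[K]}) : V :=
  \sum_(k <- msupp mu) mu@_k *: f k.

Arguments mlift {R K V} f mu.

Section FinitelySupportedMeasures.
Context {R : realType}.

(* The image (push-forward) of mu under f. *)
Definition mimage (K L : choiceType) (f : K -> L) (mu : {malg R[K]}) :
    {malg R[L]} :=
  mlift (fun k => << f k >>) mu.

(* The bilinear extension to measures of a product of points. *)
Definition mbilin (K : choiceType) (c : K -> K -> {malg R[K]})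
    (mu nu : {malg R[K]}) : {malg R[K]} :=
  mlift (fun x => mlift (fun y => c x y) nu) mu.

End FinitelySupportedMeasures.

(* hconv m n is the measure delta_m * delta_n. *)
HB.mixin Record isHypergroup (R : realType) K of Choice K := {
  hconv : K -> K -> {malg R[K]};
  hone : K;
  hinv : K -> K;
  hconv_prob : forall m n, is_prob (hconv m n);
  hconvA : forall l m n,
    mbilin hconv (hconv l m) << n >> = mbilin hconv << l >> (hconv m n);
  hconv1m : forall m, hconv hone m = << m >>;
  hconvm1 : forall m, hconv m hone = << m >>;
  hinvK : involutive hinv;
  hinv_hconv : forall m n, mimage hinv (hconv m n) = hconv (hinv n) (hinv m);
  hone_hconv : forall m n, (hone \in msupp (hconv m (hinv n))) = (m == n)
}.

#[short(type="hypergroupType")]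
HB.structure Definition Hypergroup (R : realType) :=
  {K of isHypergroup R K & Choice K}.

HB.mixin Record Hypergroup_isCommutative (R : realType) K of Hypergroup R K := {
  hconvC : forall m n : K, hconv m n = hconv n m
}.

#[short(type="comHypergroupType")]
HB.structure Definition ComHypergroup (R : realType) :=
  {K of Hypergroup_isCommutative R K & Hypergroup R K}.

Section Hypergroups.
Context {R : realType}.

Definition mconv {K : hypergroupType R} (mu nu : {malg R[K]}) : {malg R[K]} :=
  mbilin hconv mu nu.

Definition hcenter {K : hypergroupType R} : set K :=
  [set x | forall y, exists k, msupp (hconv x y) = [fset k]%fset].

(* The unique element of the support of delta_x * delta_z, for z central. *)
Definition hmul {K : hypergroupType R} (x z : K) : K :=
  xget x [set k | k \in msupp (hconv x z)].

(* In the group Z(K) the inverse of z is its image under the involution, see  *)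
(* hmulxV below.                                                              *)
Record centerSubgroup (K : hypergroupType R) := CenterSubgroup {
  csg_set :> set K;
  csg_center : csg_set `<=` hcenter;
  csg1 : csg_set hone;
  csgM : forall x y, csg_set x -> csg_set y -> csg_set (hmul x y);
  csgV : forall x, csg_set x -> csg_set (hinv x)
}.

Definition hcoset {K : hypergroupType R} (H : set K) (x : K) : set K :=
  [set hmul x z | z in H].

(* The set K//H = {xH : x in K}, as a type. *)
Definition hquot (K : hypergroupType R) (H : centerSubgroup K) : Type :=
  range (hcoset H).

HB.instance Definition _ (K : hypergroupType R) (H : centerSubgroup K) :=
  Choice.on (hquot H).

Lemma mem_hcoset (K : hypergroupType R) (H : centerSubgroup K) (x : K) :
  hcoset H x \in range (hcoset H).
Proof. by rewrite inE; exists x. Qed.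

Definition hpi (K : hypergroupType R) (H : centerSubgroup K) (x : K) : hquot H :=
  exist _ (hcoset H x) (mem_hcoset H x).

Definition hrepr (K : hypergroupType R) (H : centerSubgroup K) (A : hquot H) :
    K :=
  xget hone [set x | hpi H x = A].

(* These do not depend on the representatives, see hquot_convE and            *)
(* hquot_invE below.                                                          *)
Definition hquot_conv (K : hypergroupType R) (H : centerSubgroup K)
    (A B : hquot H) : {malg R[hquot H]} :=
  mimage (hpi H) (hconv (hrepr A) (hrepr B)).

Definition hquot_inv (K : hypergroupType R) (H : centerSubgroup K)
    (A : hquot H) : hquot H :=
  hpi H (hinv (hrepr A)).

End Hypergroups.

Section MeasureTheory.
Context {R : realType}.

Lemma mliftE (K : choiceType) (V : lmodType R) (f : K -> V)
    (mu : {malg R[K]}) :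
  mlift f mu = \sum_(k <- msupp mu) mu@_k *: f k.
Proof. by rewrite mlift.unlock. Qed.

Lemma mliftEw (K : choiceType) (V : lmodType R) (f : K -> V)
    (d : {fset K}) (mu : {malg R[K]}) :
  (msupp mu `<=` d)%fset -> mlift f mu = \sum_(k <- d) mu@_k *: f k.
Proof.
move=> sd; rewrite mliftE; apply: big_fset_incl => // k _ kmu.
by rewrite mcoeff_outdom // scale0r.
Qed.

Lemma mlift_linear (K : choiceType) (V : lmodType R) (f : K -> V)
    (a : R) (mu nu : {malg R[K]}) :
  mlift f (a *: mu + nu) = a *: mlift f mu + mlift f nu.
Proof.
pose d := (msupp (a *: mu + nu) `|` (msupp mu `|` msupp nu))%fset.
rewrite !(@mliftEw _ _ _ d) /d.
- rewrite scaler_sumr -big_split /=; apply: eq_bigr => k _.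
  by rewrite mcoeffD mcoeffZ scalerDl scalerA.
- by rewrite fsetUA fsubsetUr.
- by rewrite fsetUCA fsubsetUl.
- exact: fsubsetUl.
Qed.

HB.instance Definition _ (K : choiceType) (V : lmodType R) (f : K -> V) :=
  GRing.isLinear.Build R {malg R[K]} V _ (mlift f) (mlift_linear f).

Lemma mliftU (K : choiceType) (V : lmodType R) (f : K -> V) (k : K) :
  mlift f << k >> = f k.
Proof.
rewrite (@mliftEw _ _ _ [fset k]%fset) ?msuppU_le //.
by rewrite big_seq_fset1 mcoeffUU scale1r.
Qed.

Lemma eq_mlift (K : choiceType) (V : lmodType R) (f g : K -> V)
    (mu : {malg R[K]}) :
  {in msupp mu, f =1 g} -> mlift f mu = mlift g mu.
Proof.
by move=> fg; rewrite !mliftE big_seq [RHS]big_seq; apply: eq_bigr => k /fg ->.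
Qed.

Lemma mlift_comp (K : choiceType) (V W : lmodType R) (g : {linear V -> W})
    (f : K -> V) (mu : {malg R[K]}) :
  g (mlift f mu) = mlift (g \o f) mu.
Proof. by rewrite !mliftE linear_sum; apply: eq_bigr => k _; rewrite linearZ. Qed.

Lemma mliftD (K : choiceType) (V : lmodType R) (f g : K -> V)
    (mu : {malg R[K]}) :
  mlift (fun k => f k + g k) mu = mlift f mu + mlift g mu.
Proof. by rewrite !mliftE -big_split; apply: eq_bigr => k _; rewrite scalerDr. Qed.

Lemma mliftZ (K : choiceType) (V : lmodType R) (a : R) (f : K -> V)
    (mu : {malg R[K]}) :
  mlift (fun k => a *: f k) mu = a *: mlift f mu.
Proof.
rewrite !mliftE scaler_sumr; apply: eq_bigr => k _.
by rewrite !scalerA mulrC.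
Qed.

Lemma mlift_id (K : choiceType) (mu : {malg R[K]}) :
  mlift (fun k => << k >>) mu = mu.
Proof.
rewrite [RHS]monalgE mliftE; apply: eq_bigr => k _.
by apply/malgP => i; rewrite mcoeffZ !mcoeffU mulr_natr.
Qed.

Lemma mlift_mlift (K L : choiceType) (V : lmodType R) (g : L -> V)
    (f : K -> {malg R[L]}) (mu : {malg R[K]}) :
  mlift g (mlift f mu) = mlift (fun k => mlift g (f k)) mu.
Proof. exact: mlift_comp. Qed.

HB.instance Definition _ (K L : choiceType) (f : K -> L) :=
  GRing.Linear.copy (@mimage R K L f) (mlift (fun k => << f k >>)).

Lemma mimageU (K L : choiceType) (f : K -> L) (k : K) :
  mimage f << k >> = << f k >> :> {malg R[L]}.
Proof. exact: mliftU. Qed.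

Lemma mlift_mimage (K L : choiceType) (V : lmodType R) (g : L -> V)
    (f : K -> L) (mu : {malg R[K]}) :
  mlift g (mimage f mu) = mlift (g \o f) mu.
Proof. by rewrite mlift_mlift; apply: eq_mlift => k _; rewrite mliftU. Qed.

Lemma mimage_mimage (K L M : choiceType) (g : L -> M) (f : K -> L)
    (mu : {malg R[K]}) :
  mimage g (mimage f mu) = mimage (g \o f) mu.
Proof. exact: mlift_mimage. Qed.

Lemma mimage_mlift (K L M : choiceType) (g : L -> M) (f : K -> {malg R[L]})
    (mu : {malg R[K]}) :
  mimage g (mlift f mu) = mlift (fun k => mimage g (f k)) mu.
Proof. exact: mlift_mlift. Qed.

Lemma mcoeff_mlift (K L : choiceType) (f : K -> {malg R[L]})
    (mu : {malg R[K]}) (l : L) :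
  (mlift f mu)@_l = \sum_(k <- msupp mu) mu@_k * (f k)@_l.
Proof. by rewrite mliftE raddf_sum; apply: eq_bigr => k _; rewrite /= mcoeffZ. Qed.

Lemma mass_prob (K : choiceType) (mu : {malg R[K]}) :
  \sum_(k <- msupp mu) mu@_k = mlift (fun=> 1 : R^o) mu.
Proof.
by rewrite mliftE; apply: eq_bigr => k _; rewrite /GRing.scale /= mulr1.
Qed.

Lemma is_probU (K : choiceType) (k : K) : is_prob (<< k >> : {malg R[K]}).
Proof.
split=> [l|]; first by rewrite mcoeffU ler0n.
by rewrite mass_prob mliftU.
Qed.

Lemma is_prob_mlift (K L : choiceType) (f : K -> {malg R[L]})
    (mu : {malg R[K]}) :
  is_prob mu -> (forall k, is_prob (f k)) -> is_prob (mlift f mu).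
Proof.
move=> [mu0 mu1] fP; split=> [l|].
  by rewrite mcoeff_mlift sumr_ge0 // => k _; rewrite mulr_ge0 // (fP k).1.
rewrite mass_prob mlift_mlift -[RHS]mu1 mass_prob.
apply: (@eq_mlift _ R^o) => k _.
by rewrite -mass_prob (fP k).2.
Qed.

Lemma is_prob_mimage (K L : choiceType) (f : K -> L) (mu : {malg R[K]}) :
  is_prob mu -> is_prob (mimage f mu).
Proof. by move=> muP; apply: is_prob_mlift => // k; exact: is_probU. Qed.

Lemma msupp_mlift (K L : choiceType) (f : K -> {malg R[L]})
    (mu : {malg R[K]}) (l : L) :
  is_prob mu -> (forall k, is_prob (f k)) ->
  reflect (exists2 k, k \in msupp mu & l \in msupp (f k))
          (l \in msupp (mlift f mu)).
Proof.
move=> [mu0 _] fP; rewrite -mcoeff_neq0 mcoeff_mlift.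
have t0 k : 0 <= mu@_k * (f k)@_l by rewrite mulr_ge0 // (fP k).1.
rewrite psumr_neq0 //; apply: (iffP hasP) => -[k kmu] /=.
  rewrite lt0r mulf_eq0 negb_or -andbA => /and3P[_ fkl _].
  by exists k => //; rewrite -mcoeff_neq0.
rewrite -mcoeff_neq0 => fkl; exists k => //=.
by rewrite lt0r t0 andbT mulf_neq0 // mcoeff_neq0.
Qed.

Lemma msupp_mimage (K L : choiceType) (f : K -> L) (mu : {malg R[K]}) (l : L) :
  is_prob mu ->
  reflect (exists2 k, k \in msupp mu & f k = l) (l \in msupp (mimage f mu)).
Proof.
move=> muP; apply: (iffP (msupp_mlift _ muP _)) => [k|[k kmu]|[k kmu <-]].
- exact: is_probU.
- by rewrite msuppU oner_eq0 inE => /eqP ->; exists k.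
- by exists k => //; rewrite msuppU oner_eq0 inE.
Qed.

Lemma prob_fset1 (K : choiceType) (mu : {malg R[K]}) (k : K) :
  is_prob mu -> msupp mu = [fset k]%fset -> mu = << k >>.
Proof.
move=> [_ mu1] muk; rewrite [mu]monalgE muk big_seq_fset1; congr (<< _ *g _ >>).
by rewrite -mu1 muk big_seq_fset1.
Qed.

Lemma is_prob_neq0 (K : choiceType) (mu : {malg R[K]}) :
  is_prob mu -> exists k, k \in msupp mu.
Proof.
move=> [_ mu1]; have [mu0|[k kmu]] := fset_0Vmem (msupp mu); last by exists k.
by move: mu1; rewrite mu0 big_nil => /esym/eqP; rewrite oner_eq0.
Qed.

End MeasureTheory.

Section HypergroupTheory.
Context {R : realType} {K : hypergroupType R}.
Implicit Types (mu nu rho : {malg R[K]}) (x y z : K).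

Lemma mconvU x y : mconv << x >> << y >> = hconv x y.
Proof. by rewrite /mconv /mbilin !mliftU. Qed.

Lemma mconvUl x nu : mconv << x >> nu = mlift (hconv x) nu.
Proof. by rewrite /mconv /mbilin mliftU. Qed.

Lemma mconv_mliftl (I : choiceType) (f : I -> {malg R[K]}) (m : {malg R[I]}) nu :
  mconv (mlift f m) nu = mlift (fun i => mconv (f i) nu) m.
Proof. exact: mlift_mlift. Qed.

Lemma mconv_mliftr (I : choiceType) mu (f : I -> {malg R[K]}) (m : {malg R[I]}) :
  mconv mu (mlift f m) = mlift (fun i => mconv mu (f i)) m.
Proof.
rewrite /mconv /mbilin.
under eq_mlift do rewrite mlift_mlift.
rewrite !mliftE; under eq_bigr do rewrite mliftE scaler_sumr.
rewrite exchange_big /=; apply: eq_bigr => i _; rewrite mliftE.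
rewrite scaler_sumr; apply: eq_bigr => k _.
by rewrite !scalerA mulrC.
Qed.

Lemma mconvUr mu y : mconv mu << y >> = mlift (hconv^~ y) mu.
Proof. by apply: eq_mlift => x _; rewrite mliftU. Qed.

Lemma mconvA mu nu rho : mconv (mconv mu nu) rho = mconv mu (mconv nu rho).
Proof.
rewrite -[mu]mlift_id !mconv_mliftl; apply: eq_mlift => x _.
rewrite -[nu]mlift_id mconv_mliftr !mconv_mliftl mconv_mliftr.
apply: eq_mlift => y _.
rewrite -[rho]mlift_id !mconv_mliftr; apply: eq_mlift => z _.
by rewrite !mconvU; exact: hconvA.
Qed.

Lemma is_prob_mconv mu nu : is_prob mu -> is_prob nu -> is_prob (mconv mu nu).
Proof.
move=> muP nuP; apply: is_prob_mlift => // x; apply: is_prob_mlift => // y.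
exact: hconv_prob.
Qed.

Lemma mem_mconv mu nu k : is_prob mu -> is_prob nu ->
  reflect (exists x y, [/\ x \in msupp mu, y \in msupp nu
                         & k \in msupp (hconv x y)])
          (k \in msupp (mconv mu nu)).
Proof.
move=> muP nuP; have cP x y := hconv_prob x y : is_prob (hconv x y).
have xP x : is_prob (mlift (hconv x) nu) by exact: is_prob_mlift.
apply: (iffP (msupp_mlift _ muP xP)) => [[x xmu]|[x [y [xmu ynu kxy]]]].
  by move=> /(msupp_mlift _ nuP (cP x))[y ynu kxy]; exists x, y.
by exists x => //; apply/(msupp_mlift _ nuP (cP x)); exists y.
Qed.

Lemma hinv1 : hinv hone = hone :> K.
Proof.
have := hone_hconv (hone : K) hone; rewrite eqxx hconv1m.
by rewrite msuppU oner_eq0 inE => /eqP.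
Qed.

Lemma mdirac_inj x y : << x >> = << y >> :> {malg R[K]} -> x = y.
Proof.
move=> /(congr1 (fun m : {malg R[K]} => x \in msupp m)).
by rewrite !msuppU oner_eq0 !inE eqxx => /esym/eqP.
Qed.

Lemma hmulE x z k : hconv x z = << k >> -> hmul x z = k.
Proof.
move=> xzk; rewrite /hmul xzk msuppU oner_eq0; case: xgetP => [l _|/(_ k)] /=.
  by rewrite inE => /eqP.
by rewrite inE eqxx.
Qed.

Lemma hconv_centerl z x : hcenter z -> hconv z x = << hmul z x >>.
Proof.
move=> /(_ x)[k /(prob_fset1 (hconv_prob _ _)) zxk].
by rewrite (hmulE zxk).
Qed.

Lemma hmulxV z : hcenter z -> hmul z (hinv z) = hone.
Proof.
move=> /hconv_centerl zV; have := hone_hconv z z.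
by rewrite eqxx zV msuppU oner_eq0 inE => /eqP.
Qed.

Lemma hmulx1 x : hmul x hone = x.
Proof. by apply: hmulE; rewrite hconvm1. Qed.

End HypergroupTheory.

Section Quotient.
Context {R : realType} {K : comHypergroupType R} (H : centerSubgroup K).
Implicit Types (mu nu : {malg R[K]}) (x y z w : K).

Local Notation pi := (hpi H).

Lemma mconvC mu nu : mconv mu nu = mconv nu mu.
Proof.
rewrite -[mu]mlift_id mconv_mliftl mconv_mliftr; apply: eq_mlift => x _.
rewrite -[nu]mlift_id mconv_mliftl mconv_mliftr; apply: eq_mlift => y _.
by rewrite !mconvU hconvC.
Qed.

Lemma hconvH x z : csg_set H z -> hconv x z = << hmul x z >>.
Proof.
move=> /csg_center/hconv_centerl zx.
have -> : hmul x z = hmul z x by apply: hmulE; rewrite hconvC.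
by rewrite hconvC.
Qed.

Lemma mconvH x z : csg_set H z -> mconv << x >> << z >> = << hmul x z >>.
Proof. by move=> Hz; rewrite mconvU hconvH. Qed.

Lemma hmulHA x z w : csg_set H z -> csg_set H w ->
  hmul (hmul x z) w = hmul x (hmul z w).
Proof.
move=> Hz Hw; have Hzw := csgM Hz Hw; apply: (@mdirac_inj R).
rewrite -(mconvH _ Hw) -(mconvH _ Hz) -(mconvH _ Hzw) -(mconvH _ Hw).
exact: mconvA.
Qed.

Lemma hpi_hmul x z : csg_set H z -> pi (hmul x z) = pi x.
Proof.
move=> Hz; apply: val_inj; apply/seteqP; split => _ [w Hw <-].
  by exists (hmul z w); [exact: csgM|rewrite hmulHA].
exists (hmul (hinv z) w); first by apply: csgM => //; exact: csgV.
rewrite hmulHA //; last by apply: csgM => //; exact: csgV.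
rewrite -[hmul z _]hmulHA //; last exact: csgV.
rewrite hmulxV; last exact: csg_center Hz.
by congr hmul; apply: hmulE; rewrite hconv1m.
Qed.

Lemma hpiP x y : pi x = pi y <-> exists2 z, csg_set H z & hmul x z = y.
Proof.
split=> [/(congr1 val) /= xy|[z Hz <-]]; last by rewrite hpi_hmul.
suff : hcoset H y y by rewrite -xy => -[z Hz <-]; exists z.
by exists hone; [exact: csg1|exact: hmulx1].
Qed.

Lemma hpi_surj (A : hquot H) : exists x, pi x = A.
Proof.
case: A => A AP; have := AP; rewrite inE => -[x _ xA].
by exists x; apply: val_inj.
Qed.

Lemma hreprK (A : hquot H) : pi (hrepr A) = A.
Proof.
rewrite /hrepr; case: xgetP => [x _ //|nA].
by have [x xA] := hpi_surj A; case: (nA x).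
Qed.

Lemma hreprE x : exists2 z, csg_set H z & hrepr (pi x) = hmul x z.
Proof. by have /esym/hpiP[z Hz <-] := hreprK (pi x); exists z. Qed.

Lemma mimage_hpi_mconv mu z : csg_set H z ->
  mimage pi (mconv mu << z >>) = mimage pi mu.
Proof.
move=> Hz; rewrite mconvUr mimage_mlift; apply: eq_mlift => x _.
by rewrite hconvH // mimageU hpi_hmul.
Qed.

Lemma hconv_hmul x y z w : csg_set H z -> csg_set H w ->
  hconv (hmul x z) (hmul y w) = mconv (mconv (hconv x y) << z >>) << w >>.
Proof.
move=> Hz Hw; rewrite -[LHS]mconvU -[in RHS]mconvU.
rewrite -(mconvH _ Hz) -(mconvH _ Hw) !mconvA; congr (mconv _ _).
by rewrite -mconvA [mconv << z >> _]mconvC mconvA.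
Qed.

Lemma hquot_convE x y : hquot_conv (pi x) (pi y) = mimage pi (hconv x y).
Proof.
rewrite /hquot_conv; have [z Hz ->] := hreprE x; have [w Hw ->] := hreprE y.
by rewrite hconv_hmul // !mimage_hpi_mconv.
Qed.

Lemma hinv_hmul x z : csg_set H z -> hinv (hmul x z) = hmul (hinv x) (hinv z).
Proof.
move=> Hz; apply: (@mdirac_inj R); rewrite -hconvH; last exact: csgV.
by rewrite -mimageU -hconvH // hinv_hconv hconvC.
Qed.

Lemma hquot_invE x : hquot_inv (pi x) = pi (hinv x).
Proof.
rewrite /hquot_inv; have [z Hz ->] := hreprE x.
by rewrite hinv_hmul // hpi_hmul //; exact: csgV.
Qed.

Lemma mbilin_hquot mu nu :
  mbilin (@hquot_conv R K H) (mimage pi mu) (mimage pi nu)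
  = mimage pi (mconv mu nu).
Proof.
rewrite /mbilin mlift_mimage mimage_mlift; apply: eq_mlift => x _ /=.
rewrite mlift_mimage mimage_mlift; apply: eq_mlift => y _ /=.
exact: hquot_convE.
Qed.

Lemma hquot_prob (A B : hquot H) : is_prob (hquot_conv A B).
Proof. by apply: is_prob_mimage; exact: hconv_prob. Qed.

Lemma hquot_convA (A B C : hquot H) :
  mbilin (@hquot_conv R K H) (hquot_conv A B) << C >>
  = mbilin (@hquot_conv R K H) << A >> (hquot_conv B C).
Proof.
have [x <-] := hpi_surj A; have [y <-] := hpi_surj B; have [z <-] := hpi_surj C.
rewrite !hquot_convE -[<< pi z >>]mimageU -[<< pi x >>]mimageU !mbilin_hquot.
by rewrite -!mconvU mconvA.
Qed.

Lemma hquot_conv1m (A : hquot H) : hquot_conv (pi hone) A = << A >>.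
Proof. by have [x <-] := hpi_surj A; rewrite hquot_convE hconv1m mimageU. Qed.

Lemma hquot_convm1 (A : hquot H) : hquot_conv A (pi hone) = << A >>.
Proof. by have [x <-] := hpi_surj A; rewrite hquot_convE hconvm1 mimageU. Qed.

Lemma hquot_invK : involutive (@hquot_inv R K H).
Proof.
by move=> A; have [x <-] := hpi_surj A; rewrite !hquot_invE hinvK.
Qed.

Lemma hquot_inv_conv (A B : hquot H) :
  mimage (@hquot_inv R K H) (hquot_conv A B)
  = hquot_conv (hquot_inv B) (hquot_inv A).
Proof.
have [x <-] := hpi_surj A; have [y <-] := hpi_surj B.
rewrite !hquot_invE !hquot_convE -hinv_hconv !mimage_mimage.
by apply: eq_mlift => k _ /=; rewrite hquot_invE.
Qed.

Lemma hquot_one_conv (A B : hquot H) :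
  (pi hone \in msupp (hquot_conv A (hquot_inv B))) = (A == B).
Proof.
have [x <-] := hpi_surj A; have [y <-] := hpi_surj B.
rewrite hquot_invE hquot_convE.
have xyP := hconv_prob x (hinv y).
apply/(msupp_mimage pi _ xyP)/eqP => [[k kxy /esym/hpiP[z Hz kE]]|xy].
  have {kE} kz : z = k by rewrite -kE; apply/esym/hmulE; rewrite hconv1m.
  rewrite {}kz in Hz; apply/esym/hpiP; exists k => //.
  have HVk := csgV Hz.
  suff : hone \in msupp (hconv x (hinv (hmul y k))).
    by rewrite hone_hconv => /eqP.
  rewrite hinv_hmul // -[hconv _ _]mconvU -(mconvH _ HVk) -mconvA mconvU.
  apply/(mem_mconv _ xyP (is_probU _)); exists k, (hinv k); split => //.
    by rewrite msuppU oner_eq0 inE.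
  by rewrite hone_hconv.
have /esym/hpiP[z Hz yz] := xy.
exists z; last by rewrite -[z in pi z](hmulE (hconv1m z)) hpi_hmul.
have : hconv x (hinv y) = mconv (hconv y (hinv y)) << z >>.
  rewrite -yz -[LHS]mconvU -[hconv y _]mconvU -(mconvH _ Hz) !mconvA.
  by rewrite [mconv << z >> _]mconvC.
move=> ->; apply/(mem_mconv _ (hconv_prob _ _) (is_probU _)).
exists hone, z; split; first by rewrite hone_hconv.
  by rewrite msuppU oner_eq0 inE.
by rewrite hconv1m msuppU oner_eq0 inE.
Qed.

Lemma hquot_convC (A B : hquot H) : hquot_conv A B = hquot_conv B A.
Proof. by rewrite /hquot_conv hconvC. Qed.

HB.instance Definition _ := isHypergroup.Build R (hquot H)
  hquot_prob hquot_convA hquot_conv1m hquot_convm1 hquot_invK hquot_inv_conv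
  hquot_one_conv.

HB.instance Definition _ := Hypergroup_isCommutative.Build R (hquot H)
  hquot_convC.

End Quotient.

Notation "K // H" := (@hquot _ K H) (at level 40) : type_scope.

Section AlmostRamsey.
Context {R : realType} {L : hypergroupType R}.

(* delta_(x n_1) * ... * delta_(x n_m) for s = [:: n_1; ...; n_m], with a      *)
(* trailing factor delta_e, which is neutral.                                 *)
Definition hdelta (x : nat -> L) (s : seq nat) : {malg R[L]} :=
  foldr (fun n mu => mconv << x n >> mu) << hone >> s.

(* When x is injective, a nonempty finite subset {x n_1, ..., x n_m} of its   *)
(* range with n_1 < ... < n_m is the same as a nonempty increasing sequence   *)
(* [:: n_1; ...; n_m].                                                        *)
Definition SFC (x : nat -> L) : set {fset L} :=
  [set msupp (hdelta x s) | s in [set s | s != [::] /\ sorted ltn s]].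

End AlmostRamsey.

Definition almost_ramsey (R : realType) (L : hypergroupType R) : Prop :=
  infinite_set [set: L] /\
  forall (r : nat) (C : 'I_r -> set L),
    partition [set: 'I_r] C [set: L] ->
    exists (i : 'I_r) (x : nat -> L) (F : set {fset L}),
      [/\ injective x, forall n, x n != hone, finite_set F, F `<=` SFC x &
          forall S, (SFC x `\` F) S -> [set` S] `<=` C i].

(* Main.v *)
(* The projection pi : K -> K//H has finite fibers, each being a coset of H,   *)
(* and maps the product of a finite family to the product of its image.  Pull *)
(* a partition of K//H back along pi, take a sequence of K homogeneous for    *)
(* the pulled-back partition, and pass to a subsequence along which pi is     *)
(* injective and avoids the identity.                                         *)
Require Import Defs.
From HB Require Import structures.
From mathcomp Require Import all_boot all_order all_algebra finmap.
From mathcomp.multinomials Require Import monalg.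
From mathcomp Require Import mathcomp_extra boolp classical_sets functions.
From mathcomp Require Import cardinality reals.

Set Implicit Arguments.
Unset Strict Implicit.

Local Open Scope classical_set_scope.

(** Since [hpi H] is multiplicative, it carries [SFC x] onto [SFC (hpi H \o x)] ([SFC_hpi]), so
    homogeneity for a pulled-back partition descends to the quotient. The image sequence may still
    repeat values or hit the identity. Fibers of [hpi H] are finite and [x] is injective, so each
    value occurs finitely often and [finite_fibers_inj_subseq] thins the sequence; by [SFC_subseq]
    this creates no new supports. *)

Lemma finite_set_nat_bounded (A : set nat) :
  finite_set A -> exists N, forall n, N <= n -> ~ A n.
Proof.
move=> /finite_seqP[s sA]; exists (\max_(i <- s) i).+1 => n + An.
rewrite ltnNge => /negP; apply; apply: leq_bigmax_seq => //.
by move: An; rewrite sA.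
Qed.

(** Start past the last occurrence of [a], then repeatedly jump from an index [N] to some [h N] from
    which on [f N] never recurs. *)
Lemma finite_fibers_inj_subseq (T : Type) (f : nat -> T) (a : T) :
  (forall b, finite_set (f @^-1` [set b])) ->
  exists g : nat -> nat, [/\ {homo g : i j / i < j}, injective (f \o g) &
    forall n, f (g n) <> a].
Proof.
move=> finf.
have /choice[h hP] N : exists M, N < M /\ forall m, M <= m -> f m <> f N.
  have [M MP] := finite_set_nat_bounded (finf (f N)).
  exists (maxn M N.+1); split; first exact: leq_maxr.
  by move=> m; rewrite geq_max => /andP[/MP].
have [M0 M0P] := finite_set_nat_bounded (finf a).
pose g n := iter n h M0.
have g_incr : {homo g : i j / i < j}.
  by apply: homo_ltn => [|n]; [exact: ltn_trans|exact: (hP _).1].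
have g_mono : {homo g : i j / i <= j} by exact: ltnW_homo.
have fgN i j : i < j -> f (g j) <> f (g i).
  (* [i < j] unfolds to [i.+1 <= j], and [g i.+1] is [h (g i)]. *)
  by move=> /g_mono; exact: (hP (g i)).2.
exists g; split=> // [i j /= fgij|n].
  by case: (ltngtP i j) => // /fgN; rewrite fgij.
exact/M0P/(g_mono 0).
Qed.

Section ProductsOfSequences.
Context {R : realType} {L : hypergroupType R}.

Lemma is_prob_hdelta (x : nat -> L) s : is_prob (hdelta x s).
Proof.
elim: s => [|n s IHs]; first exact: is_probU.
by apply: is_prob_mconv => //; exact: is_probU.
Qed.

Lemma hdelta_comp (x : nat -> L) (g : nat -> nat) s :
  hdelta (x \o g) s = hdelta x (map g s).
Proof. by rewrite /hdelta foldr_map. Qed.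

Lemma SFC_subseq (x : nat -> L) (g : nat -> nat) :
  {homo g : i j / i < j} -> SFC (x \o g) `<=` SFC x.
Proof.
move=> g_incr _ [s [s0 s_incr] <-]; rewrite hdelta_comp.
exists (map g s) => //; split; first by case: s s0 {s_incr}.
exact: homo_sorted s_incr.
Qed.

End ProductsOfSequences.

Section QuotientMap.
Context {R : realType} {K : comHypergroupType R} (H : centerSubgroup K).

Local Notation pi := (hpi H).

Lemma hdelta_hpi (x : nat -> K) s :
  hdelta (pi \o x : nat -> K // H) s = mimage pi (hdelta x s).
Proof.
elim: s => [|n s IHs] /=; first by rewrite mimageU.
by rewrite IHs -mbilin_hquot mimageU.
Qed.

Lemma msupp_mimage_fset (I J : choiceType) (f : I -> J) (mu : {malg R[I]}) :
  is_prob mu -> msupp (mimage f mu) = (f @` msupp mu)%fset.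
Proof.
move=> muP; apply/fsetP => j.
apply/(msupp_mimage f j muP)/imfsetP => [[k kmu fk]|[k kmu ->]].
  by exists k.
by exists k.
Qed.

Lemma SFC_hpi (x : nat -> K) :
  SFC (pi \o x : nat -> K // H) = [set (pi @` S)%fset | S in SFC x].
Proof.
rewrite /SFC image_comp; apply: eq_imagel => s _ /=.
by rewrite hdelta_hpi msupp_mimage_fset //; exact: is_prob_hdelta.
Qed.

(** The fiber over the class of [x] lies in the image of [H] under [hmul x]. *)
Lemma finite_hpi_fiber (A : K // H) :
  finite_set H -> finite_set (pi @^-1` [set A]).
Proof.
have [x <-] := hpi_surj A => finH.
apply: sub_finite_set (finite_image (hmul x) finH).
by move=> y /= /esym/hpiP[z Hz <-]; exists z.
Qed.

Lemma infinite_hquot :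
  finite_set H -> infinite_set [set: K] -> infinite_set [set: K // H].
Proof.
move=> finH infK finKH; apply: infK.
have -> : [set: K] = \bigcup_(A in [set: K // H]) pi @^-1` [set A].
  by apply/seteqP; split=> // x _; exists (pi x).
by apply: bigcup_finite => // A _; exact: finite_hpi_fiber.
Qed.

Lemma partition_preimage_hpi (r : nat) (D : 'I_r -> set (K // H)) :
  partition [set: 'I_r] D [set: K // H] ->
  partition [set: 'I_r] (fun i => pi @^-1` D i) [set: K].
Proof.
move=> [coverD trivD D0]; split.
- apply/seteqP; split=> // x _.
  by have: [set: K // H] (pi x) by []; rewrite -coverD => -[j _ Dj]; exists j.
- by move=> i j _ _ [x [Di Dj]]; apply: trivD => //; exists (pi x).
(* Blocks must be nonempty; surjectivity of [pi] preserves this. *)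
- by move=> i /D0[A DA]; have [x xA] := hpi_surj A; exists x; rewrite /= xA.
Qed.

End QuotientMap.

Theorem theorem3p11 (R : realType) (K : comHypergroupType R)
    (H : centerSubgroup K) (finH : finite_set H) :
  almost_ramsey K -> almost_ramsey (K // H).
Proof.
move=> [infK ramseyK]; split; first exact: infinite_hquot.
move=> r D /partition_preimage_hpi/ramseyK[i [x [F [x_inj _ finF _ xD]]]].
have [b|g [g_incr pixg_inj pixg1]] :=
    @finite_fibers_inj_subseq (K // H) (hpi H \o x) hone.
  rewrite comp_preimage; apply: finite_preimage; last exact: finite_hpi_fiber.
  exact: in2W.
(* Intersecting with [SFC (x \o g)] keeps the exceptional family inside the new [SFC]. *)
exists i, (hpi H \o (x \o g)), [set (hpi H @` S)%fset | S in F `&` SFC (x \o g)].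
rewrite SFC_hpi; split=> //.
- by move=> n; apply/eqP; exact: pixg1.
- exact/finite_image/finite_setIl.
- by apply: image_subset; exact: subIsetr.
(* If the image of [S] is not exceptional, then [S] is not in [F], so [xD] applies to [S]. *)
- move=> _ [[S xS <-] nFS] _ /imfsetP[k /= kS ->].
  apply: (xD S) => //; split; first exact: (SFC_subseq g_incr).
  by move=> FS; apply: nFS; exists S.
Qed.
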